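(* Suppose that a metric Polish probability space $(\mathfrak{X},d,\mu)$ is asymptotically disintegrable with rate $(\epsilon,r)$. For $n$ sufficiently large, let $X_1,\dots,X_n$ be i.i.d. random variables with distribution $\mu$ on a probability space, with empirical measure $\hat{\mu}_n:=\frac{1}{n}\sum_{i=1}^n\delta_{X_i}$. Then: (i) For any $p\in[1,\infty)$, with probability at least $1-\epsilon(n)$, one has $W_p(\mu,\hat{\mu}_n)\leq r(n)$. (ii) With probability at least $1-\epsilon(n)$, one has $$\bigg|\int f(x)\,\mu(dx)-\int f(x)\,\hat{\mu}_n(dx)\bigg|\leq r(n)\cdot\frac{1}{n}\sum_{i=1}^n\|f\|_{\mathrm{Lip},B(X_i,r(n))}$$ for every Lipschitz function $f:\mathfrak{X}\rightarrow\mathbb{R}$ (simultaneously, on a single event).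
   Context: $\mathbb{N}=\{1,2,\dots\}$ and $[n]=\{1,\dots,n\}$. A metric Polish space is a pair $(\mathfrak{X},d)$ where $\mathfrak{X}$ is a Polish space and $d$ is a (not necessarily complete) metric generating its topology; a metric Polish probability space $(\mathfrak{X},d,\mu)$ has in addition a Borel probability measure $\mu$. $B(x,r)=\{y\in\mathfrak{X}: d(x,y)\leq r\}$ is the closed ball. Given $n\in\mathbb{N}$, $\epsilon>0$, $r>0$, $(\mathfrak{X},d,\mu)$ is $(n,\epsilon,r)$-disintegrable if, whenever $X_1,\dots,X_n$ are i.i.d. with distribution $\mu$ on a probability space $(\Psi,\mathcal{F},\mathbb{P})$, with $\mathbb{P}$-probability at least $1-\epsilon$ (i.e. on some event of probability at least $1-\epsilon$) there exists a disintegration of $\mu$ along the random multifunction $x\mapsto\{i\in[n]: x\in B(X_i,r)\}$ with respect to the uniform measure on $[n]$; that is, there exist Borel probability measures $\mu_1,\dots,\mu_n$ on $\mathfrak{X}$ with $\mu_i(B(X_i,r))=1$ for all $i$ and $\mu=\frac1n\sum_{i=1}^n\mu_i$. Given functions $\epsilon,r:\mathbb{N}\rightarrow\mathbb{R}_{\geq0}$ tending to zero as $n\rightarrow\infty$, $(\mathfrak{X},d,\mu)$ is asymptotically disintegrable with rate $(\epsilon,r)$ if for all $n$ sufficiently large it is $(n,\epsilon(n),r(n))$-disintegrable. For Borel probability measures $\mu,\nu$ on $\mathfrak{X}$ and $p\in[1,\infty)$, $W_p(\mu,\nu):=\inf_{\lambda}\big(\int d(x,x')^p\,\lambda(dx,dx')\big)^{1/p}$,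 the infimum being over all Borel probability measures $\lambda$ on $\mathfrak{X}\times\mathfrak{X}$ with marginals $\mu$ and $\nu$. $\|f\|_{\mathrm{Lip},B(x,r)}$ denotes the local Lipschitz constant of $f$ over $B(x,r)$, i.e. the (smallest) Lipschitz constant of the restriction of $f$ to $B(x,r)$. *)

(* Defs.v *)
From HB Require Import structures.
From mathcomp Require Import all_boot all_order all_algebra.
From mathcomp Require Import all_classical all_reals all_analysis.

Set Implicit Arguments.
Unset Strict Implicit.
Unset Printing Implicit Defensive.

Import Order.TTheory GRing.Theory Num.Theory.
Import numFieldNormedType.Exports.

Local Open Scope classical_set_scope.
Local Open Scope ring_scope.

(* The library's measurable types are pointed, so a metric space must be
   pointed to carry its Borel sigma-algebra. This is no restriction for a
   space on which a probability measure is given. *)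
#[short(type="pmetricType")]
HB.structure Definition PointedMetric (K : numDomainType) :=
  {M of Metric K M & isPointed M}.

(* [borel (T * T)] is generated by the open sets of the product topology; it
   is not the library's product sigma-algebra on [borel T * borel T]. *)
Notation borel T := (g_sigma_algebraType (@open T)).

Section metric_space.
Context {R : realType}.
Implicit Type T : pmetricType R.

Definition is_metric T (rho : T -> T -> R) : Prop :=
  [/\ forall x y, rho x y = 0 <-> x = y,
      forall x y, rho x y = rho y x &
      forall x y z, rho x z <= rho x y + rho y z].

Definition generates_topology T (rho : T -> T -> R) : Prop :=
  forall (x : T) (A : set T),
    nbhs x A <-> exists2 e : R, 0 < e & [set y | rho x y < e] `<=` A.

Definition complete_metric T (rho : T -> T -> R) : Prop :=
  forall u : nat -> T,
    (forall e : R, 0 < e -> exists N : nat,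
       forall m n : nat, (N <= m)%N -> (N <= n)%N -> rho (u m) (u n) < e) ->
    exists l : T, u @ \oo --> l.

(* Polishness is a property of the topology: the complete metric [rho] need
   not be the metric [mdist] of [T]. *)
Definition polish T : Prop :=
  (exists2 D : set T, countable D & dense D) /\
  exists rho : T -> T -> R,
    [/\ is_metric rho, generates_topology rho & complete_metric rho].

(* The library's [closed_ball] is the closure of the open ball, which may be
   smaller. *)
Definition cball T (x : T) (r : R) : set T := [set y | mdist x y <= r].

Definition lipschitz_const T (A : set T) (f : T -> R) (L : R) : Prop :=
  0 <= L /\ forall x y, A x -> A y -> `|f x - f y| <= L * mdist x y.

Definition lipschitz_fun T (f : T -> R) : Prop :=
  exists L : R, lipschitz_const setT f L.

Definition lip_norm T (f : T -> R) (A : set T) : \bar R :=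
  ereal_inf [set L%:E | L in lipschitz_const A f].

End metric_space.

Section uniform_mixture.
Local Open Scope ereal_scope.
Context d (T : measurableType d) (R : realType) (n : nat).
Variable nu : 'I_n -> {measure set T -> \bar R}.

Definition umix (A : set T) : \bar R :=
  (n%:R^-1)%:E * \sum_(i < n) nu i A.

Let umix0 : umix set0 = 0.
Proof. by rewrite /umix big1 ?mule0. Qed.

Let umix_ge0 A : 0 <= umix A.
Proof. by rewrite /umix mule_ge0 ?lee_fin ?invr_ge0// sume_ge0. Qed.

Let umix_sigma_additive : semi_sigma_additive umix.
Proof.
move=> F mF tF mUF; rewrite [X in _ --> X](_ : _ =
    lim ((fun k => \sum_(0 <= i < k) umix (F i)) @ \oo)).
  by apply: is_cvg_ereal_nneg_natsum => k _; exact: umix_ge0.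
rewrite /umix nneseriesZl; last by move=> i _; exact: sume_ge0.
congr (_ * _); rewrite nneseries_sum//.
apply: eq_bigr => i _; exact: measure_semi_bigcup.
Qed.

HB.instance Definition _ := isMeasure.Build _ _ _ umix
  umix0 umix_ge0 umix_sigma_additive.

End uniform_mixture.

Section probability.
Context {R : realType}.

Definition empirical_measure d (T : measurableType d) n (x : 'I_n -> T)
    : {measure set T -> \bar R} :=
  umix (fun i => \d_(x i)).

Definition with_probability_ge d (Psi : measurableType d)
    (P : probability Psi R) (q : R) (A : set Psi) : Prop :=
  exists E : set Psi, [/\ measurable E, (q%:E <= P E)%E & E `<=` A].

Definition iid d d' (Psi : measurableType d) (T : measurableType d')
    (P : probability Psi R) n (X : 'I_n -> {RV P >-> T})
    (mu : probability T R) : Prop :=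
  (forall i (A : set T), measurable A -> distribution P (X i) A = mu A) /\
  (forall A : 'I_n -> set T, (forall i, measurable (A i)) ->
     P (\bigcap_i (X i @^-1` A i)) =
     (\prod_(i < n) P (X i @^-1` A i))%E).

Definition coupling (T : pmetricType R)
    (mu nu : {measure set (borel T) -> \bar R})
    : set (probability (borel (T * T)%type) R) :=
  [set lambda : probability (borel (T * T)%type) R |
     forall A : set (borel T), measurable A ->
       lambda (fst @^-1` A) = mu A /\ lambda (snd @^-1` A) = nu A].

Definition wasserstein (p : R) (T : pmetricType R)
    (mu nu : {measure set (borel T) -> \bar R}) : \bar R :=
  ereal_inf [set ((\int[lambda]_z ((mdist z.1 z.2) `^ p)%:E) `^ p^-1)%E
            | lambda in coupling mu nu].

End probability.

Section disintegrable.
Context {R : realType} (T : pmetricType R) (mu : probability (borel T) R).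

Definition disintegration n (r : R) (x : 'I_n -> T)
    (nu : 'I_n -> probability (borel T) R) : Prop :=
  (forall i, nu i (cball (x i) r) = 1%E) /\
  (forall A : set (borel T), measurable A -> mu A = umix nu A).

(* No positivity is required of [eps] and [r], since rates may vanish. *)
Definition disintegrable (n : nat) (eps r : R) : Prop :=
  forall (d : measure_display) (Psi : measurableType d)
    (P : probability Psi R) (X : 'I_n -> {RV P >-> borel T}),
  iid X mu ->
  with_probability_ge P (1 - eps)
    [set w | exists nu, disintegration r (fun i => X i w) nu].

Definition rate (e : nat -> R) : Prop :=
  (forall n, (0 < n)%N -> 0 <= e n) /\ e @ \oo --> (0 : R).

Definition asymptotically_disintegrable (eps r : nat -> R) : Prop :=
  [/\ rate eps, rate r & \forall n \near \oo, disintegrable n (eps n) (r n)].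

End disintegrable.

(* Main.v *)
From HB Require Import structures.
Require Import Defs.
From mathcomp Require Import all_boot all_order all_algebra.
From mathcomp Require Import all_classical all_reals all_analysis.
From mathcomp Require Import measurable_realfun lra.

Import Order.TTheory GRing.Theory Num.Theory.
Import numFieldNormedType.Exports.

Local Open Scope classical_set_scope.
Local Open Scope ring_scope.

(** Both bounds hold on the same event, the one on which the disintegration
    exists; on it they are deterministic facts about points [x i] and
    probabilities [nu i], each carried by the closed ball of radius [r] around
    [x i], whose average is [mu].

    For the Wasserstein distance, send all the mass of [nu i] to [x i]: the
    average over [i] of the products of [nu i] with the Dirac mass at [x i]
    has marginals [mu] and the empirical measure, and it is carried by the
    pairs at distance at most [r]. Its transport cost of order [p] is thus at
    most [r ^ p], for every [p] ([wasserstein_le]).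

    For test functions, the difference of the two integrals is the average
    over [i] of the integrals of [f - f (x i)] against [nu i]. On the ball
    around [x i] the integrand is at most [r] times the local Lipschitz
    constant of [f], because the centre belongs to the ball
    ([empirical_integral_bound]). Integrability of [f] comes for free, since
    [f] is bounded on each ball.

    Both arguments rest on bounding an integral against a probability by a
    bound of the integrand on a set of full measure
    ([integral_abse_le_on_full_set]). *)

(** * Borel measurability of continuous functions *)

Lemma open_borel_measurable (S : ptopologicalType) (A : set (borel S)) :
  open (A : set S) -> measurable A.
Proof. exact: sub_sigma_algebra. Qed.

Lemma continuous_borel_measurable (S U : ptopologicalType) (f : S -> U) :
  continuous f -> measurable_fun [set: borel S] (f : borel S -> borel U).
Proof.
move=> /continuousP cf.
apply: (measurability _ (erefl : @measurable _ (borel U) = <<s @open U >>)).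
move=> _ [A oA <-]; rewrite setTI; apply: open_borel_measurable; exact: cf.
Qed.

(** The sigma-algebra of [R] is generated by half-open intervals rather than by
    [open], hence a separate statement for real functions. *)
Lemma continuous_borel_measurableR (R : realType) (S : ptopologicalType)
    (f : S -> R) :
  continuous f -> measurable_fun [set: borel S] (f : borel S -> R).
Proof.
move=> /continuousP cf; apply: (measurability _ (RGenOpens.measurableE R)).
move=> _ [_ [a [b ->] <-]]; rewrite setTI; apply: open_borel_measurable.
exact/cf/interval_open.
Qed.

(** * Distance, balls and Lipschitz functions *)

Lemma mdist_continuous (R : realType) (T : pmetricType R) :
  continuous (fun z : T * T => mdist z.1 z.2 : R).
Proof.
move=> [x y]; apply/cvgrPdist_lt => e e0 /=.
have e20 : 0 < e / 2 by rewrite divr_gt0.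
exists (ball x (e / 2), ball y (e / 2)); first by split; exact: nbhsx_ballx.
move=> [x' y'] [/=]; rewrite !ballEmdist /= => xx' yy'.
have h1 := metric_triangle x x' y; have h2 := metric_triangle x' y' y.
have h3 := metric_triangle x' x y'; have h4 := metric_triangle x y y'.
rewrite (metric_sym y' y) in h2; rewrite (metric_sym x' x) in h3.
rewrite (splitr e) ltr_norml; apply/andP; split; lra.
Qed.

(** Joins the pointed and the topological structures of a product, so that
    continuity into [S * U] yields measurability for [borel (S * U)]. *)
HB.instance Definition _ (S U : ptopologicalType) := Pointed.on (S * U)%type.

Lemma pair_continuous (S U : ptopologicalType) (u : U) :
  continuous (fun y : S => (y, u)).
Proof. by move=> y; apply: cvg_pair; [exact: cvg_id|exact: cvg_cst]. Qed.

Lemma cball_measurable (R : realType) (T : pmetricType R) (x : T) (r : R) :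
  measurable (cball x r : set (borel T)).
Proof.
have mx : measurable_fun setT (fun y : borel T => mdist (y : T) x : R).
  apply: continuous_borel_measurableR => y.
  exact: continuous_comp (pair_continuous _ _ x y)
    (mdist_continuous _ _ (y, x)).
rewrite (_ : cball x r = [set: borel T] `&`
    (fun y => mdist (y : T) x) @^-1` `]-oo, r]%classic).
  exact: mx.
by apply/seteqP; split=> y /=; rewrite in_itv/= metric_sym// => -[].
Qed.

Lemma lipschitz_continuous (R : realType) (T : pmetricType R) (f : T -> R) :
  lipschitz_fun f -> continuous f.
Proof.
move=> [L [L0 Lf]] x; apply/cvgrPdist_lt => e e0.
(* [L] may vanish, so the modulus of continuity divides by [L + 1]. *)
have L1 : 0 < L + 1 by rewrite ltr_wpDl.
apply: filterS (nbhsx_ballx x _ (divr_gt0 e0 L1)).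
move=> y; rewrite ballEmdist /= ltr_pdivlMr// => xy.
apply: le_lt_trans xy; apply: (le_trans (Lf _ _ I I)).
by rewrite mulrC ler_wpM2l ?mdist_ge0 ?lerDl.
Qed.

(** The infimum defining the local Lipschitz constant is a minimum: each of the
    inequalities [`|f x - f y| / mdist x y <= L] passes to the infimum over
    [L]. It is finite because a global constant is also a local one. *)
Lemma lip_norm_attained (R : realType) (T : pmetricType R) (f : T -> R)
    (A : set T) : lipschitz_fun f ->
  exists2 c : R, lip_norm f A = c%:E & lipschitz_const A f c.
Proof.
move=> [L [L0 Lf]].
have LA : lipschitz_const A f L by split=> // x y _ _; exact: Lf.
have cL : (lip_norm f A <= L%:E)%E by apply: ereal_inf_lbound; exists L.
have c0 : (0 <= lip_norm f A)%E.
  by apply: le_ereal_inf_tmp => _ [M [M0 _] <-]; rewrite lee_fin.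
have cfin : lip_norm f A \is a fin_num.
  by rewrite ge0_fin_numE// (le_lt_trans cL)// ltry.
exists (fine (lip_norm f A)); first by rewrite fineK.
split; first exact: fine_ge0.
move=> x y Ax Ay; have [->|xy] := eqVneq x y.
  by rewrite subrr normr0 mulr_ge0 ?fine_ge0 ?mdist_ge0.
rewrite -ler_pdivrMr ?mdist_gt0// -lee_fin fineK//.
apply: le_ereal_inf_tmp => _ [M [_ Mf] <-].
by rewrite lee_fin ler_pdivrMr ?mdist_gt0//; exact: Mf.
Qed.

(** * Integrals of functions bounded on a set of full probability *)

Section probability_bounds.
Context (R : realType) d (S : measurableType d) (P : probability S R).
Local Open Scope ereal_scope.

Lemma integral_abse_le_on_full_set (A : set S) (g : S -> R) (M : R) :
  measurable A -> P A = 1 -> measurable_fun setT g -> (0 <= M)%R ->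
  (forall y, A y -> (`|g y| <= M)%R) -> \int[P]_y `|(g y)%:E| <= M%:E.
Proof.
move=> mA PA1 mg M0 gM; rewrite -[leRHS]mule1 -(@probability_setT _ _ _ P).
apply: integral_le_bound => //; first exact/measurable_EFinP.
exists (~` A); split.
- exact: measurableC.
- by apply: etrans (probability_setC P mA) _; rewrite PA1 subee.
- by move=> y /= /not_implyP[_ gy] /gM; rewrite -lee_fin -abse_EFin.
Qed.

(** Integrability is a conclusion here: [f] is within [M] of the constant [a]
    on a set of full measure, though it may be unbounded elsewhere. *)
Lemma integral_sub_le_on_full_set (A : set S) (f : S -> R) (a M : R) :
  measurable A -> P A = 1 -> measurable_fun setT f -> (0 <= M)%R ->
  (forall y, A y -> (`|f y - a| <= M)%R) ->
  P.-integrable setT (EFin \o f) /\ `| \int[P]_y (f y)%:E - a%:E | <= M%:E.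
Proof.
move=> mA PA1 mf M0 faM.
have mfa : measurable_fun setT (fun y => f y - a)%R by exact: measurable_funB.
have b := integral_abse_le_on_full_set _ _ _ mA PA1 mfa M0 faM.
have ifa : P.-integrable setT (EFin \o (fun y => f y - a)%R).
  apply/integrableP; split; first exact/measurable_EFinP.
  exact: le_lt_trans b (ltry _).
have ia : P.-integrable setT (EFin \o cst a).
  by apply: finite_measure_integrable_cst.
have if_ : P.-integrable setT (EFin \o f).
  rewrite (_ : _ \o f = (EFin \o (fun y => f y - a)%R) \+ (EFin \o cst a)).
    exact: integrableD.
  by apply/funext => y /=; rewrite -EFinD subrK.
split => //; apply: le_trans b.
rewrite -[a%:E]mule1 -(@probability_setT _ _ _ P) -integral_cst//.
rewrite -integralB_EFin//.
by apply: le_abse_integral => //; exact/measurable_EFinP.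
Qed.

End probability_bounds.

(** * Integration against a uniform mixture *)

Section mixture_integrals.
Context (R : realType) d (S : measurableType d) (n : nat).
Variable nu : 'I_n -> {measure set S -> \bar R}.
Local Open Scope ereal_scope.

(** A uniform mixture is a scaled finite sum of measures, and integrals of
    nonnegative functions against those are known. *)
Lemma ge0_integral_umix (f : S -> \bar R) :
  measurable_fun setT f -> (forall y, 0 <= f y) ->
  \int[umix nu]_y f y = (n%:R^-1)%:E * \sum_(i < n) \int[nu i]_y f y.
Proof.
move=> mf f0.
have n0 : (0 <= n%:R^-1 :> R)%R by rewrite invr_ge0.
(* [msum] sums a sequence of measures, so the family is extended by zero. *)
pose nu' (k : nat) : {measure set S -> \bar R} :=
  if insub k is Some i then nu i else mzero.
have nu'E (i : 'I_n) : nu' i = nu i by rewrite /nu' valK.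
rewrite (@eq_measure_integral _ _ _ _ (mscale (NngNum n0) (msum nu' n))).
  rewrite ge0_integral_mscale// ge0_integral_measure_sum//.
  by congr (_ * _); apply: eq_bigr => i _; rewrite nu'E.
move=> A mA _; rewrite /= /umix /mscale /msum /=.
by congr (_ * _); apply: eq_bigr => i _; rewrite nu'E.
Qed.

(** Integrability against every component keeps the integrals of the positive
    and negative parts finite, so that the difference of the two averages is
    the average of the differences. *)
Lemma integral_umix (f : S -> \bar R) :
  (forall i, (nu i).-integrable setT f) -> measurable_fun setT f ->
  \int[umix nu]_y f y = (n%:R^-1)%:E * \sum_(i < n) \int[nu i]_y f y.
Proof.
move=> intf mf; rewrite integralE.
rewrite !ge0_integral_umix//; try exact/measurable_funepos;
  try exact/measurable_funeneg.
rewrite -muleBr//; last first.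
  apply: fin_num_adde_defr; apply/sum_fin_numP => i _ _.
  exact: integrable_pos_fin_num.
congr (_ * _); rewrite -fin_num_sumeN; last first.
  by move=> i _; exact: integrable_neg_fin_num.
by rewrite -big_split; apply: eq_bigr => i _; rewrite [RHS]integralE.
Qed.

Lemma umix_full_set (A : set S) :
  (0 < n)%N -> (forall i, nu i A = 1) -> umix nu A = 1.
Proof.
move=> n0 nuA; rewrite /umix (eq_bigr (fun=> 1)); last first.
  by move=> i _; exact: nuA.
rewrite sumEFin big_const_ord iter_addr_0 -EFinM -[(1 *+ n)%R]/(n%:R)%R.
by rewrite mulVf// pnatr_eq0 -lt0n.
Qed.

End mixture_integrals.

(** * Consequences of a disintegration *)

Section disintegration_bounds.
Context (R : realType) (T : pmetricType R) (n : nat).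
Local Open Scope ereal_scope.

Definition pair_with (u : T) (y : borel T) : borel (T * T)%type := (y, u).

Lemma measurable_pair_with u : measurable_fun setT (pair_with u).
Proof. exact: continuous_borel_measurable (pair_continuous _ _ u). Qed.

HB.instance Definition _ u :=
  isMeasurableFun.Build _ _ _ _ (pair_with u) (measurable_pair_with u).

(** The law of [(Y, x i)] when [i] is uniform and [Y] has law [nu i]: the
    transport plan that collapses each [nu i] onto [x i]. *)
Definition matching (x : 'I_n -> borel T)
    (nu : 'I_n -> probability (borel T) R) :
    {measure set (borel (T * T)%type) -> \bar R} :=
  umix (fun i => distribution (nu i) (pair_with (x i))).

(** The plan [matching x nu] is a coupling whose cost is at most [r ^ p], since
    it only moves mass within the balls; the infimum is below that cost. *)
Lemma wasserstein_le (mu : probability (borel T) R) (x : 'I_n -> borel T)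
    (nu : 'I_n -> probability (borel T) R) (r p : R) :
  (0 < n)%N -> (0 <= r)%R -> (1 <= p)%R -> disintegration mu r x nu ->
  wasserstein p mu (empirical_measure x) <= r%:E.
Proof.
move=> n0 r0 p1 [nu1 muE].
have p0 : (0 < p)%R by exact: lt_le_trans p1.
have L1 : matching x nu setT = 1.
  by apply: umix_full_set => // i; exact: probability_setT.
pose L : probability (borel (T * T)%type) R :=
  HB.pack (Measure.sort (matching x nu))
    (Measure_isProbability.Build _ _ _ (matching x nu) L1).
have LE A : L A = matching x nu A by [].
apply: (@le_trans _ _ ((\int[L]_z ((mdist z.1 z.2) `^ p)%:E) `^ p^-1)).
  apply: ereal_inf_lbound; exists L => //.
  move=> A mA; rewrite !LE; split.
    by apply: etrans (esym (muE A mA)).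
  congr (_ * _); apply: eq_bigr => i _.
  (* The second marginal: [(y, x i)] lies over [A] for all [y] or for none,
     so its mass under [nu i] is the Dirac mass of [A] at [x i]. *)
  transitivity (nu i [set _ | A (x i)]); first by [].
  rewrite /= diracE; case: (boolP (x i \in A)) => [/set_mem|/negP] xA.
    rewrite (_ : mkset _ = setT); first exact: probability_setT.
    by apply/seteqP; split.
  rewrite (_ : mkset _ = set0); first exact: measure0.
  by apply/seteqP; split => // y /= /mem_set.
have mD : measurable_fun setT
    (fun z : borel (T * T)%type => mdist (z.1 : T) z.2 : R).
  exact: continuous_borel_measurableR (mdist_continuous R T).
have : \int[L]_z ((mdist z.1 z.2) `^ p)%:E <= (r `^ p)%:E.
  under eq_integral do rewrite -[_%:E]gee0_abs ?lee_fin ?powR_ge0//.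
  apply: (integral_abse_le_on_full_set _ _ _ _
    [set z : borel (T * T)%type | mdist (z.1 : T) z.2 <= r]%R).
  - rewrite (_ : mkset _ = setT `&` (fun z : borel (T * T)%type =>
        mdist (z.1 : T) z.2 : R) @^-1` `]-oo, r]%classic); first exact: mD.
    by apply/seteqP; split=> z /=; rewrite in_itv//= => -[].
  - rewrite LE; apply: umix_full_set => // i.
    rewrite -(nu1 i) /distribution /pushforward; congr (nu i _).
    by apply/seteqP; split=> y /=; rewrite /cball /= metric_sym.
  - exact: (measurableT_comp (measurable_powR p) mD).
  - exact: powR_ge0.
  - move=> z /= zr; rewrite ger0_norm ?powR_ge0//.
    by rewrite ge0_ler_powR ?nnegrE ?mdist_ge0// ltW.
move=> /(gt0_ler_poweR (r := p^-1)) => /(_ _ _ _)/le_trans; apply.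
- by rewrite invr_ge0 ltW.
- by rewrite in_itv/= leey integral_ge0// => z _; rewrite lee_fin powR_ge0.
- by rewrite in_itv/= leey lee_fin powR_ge0.
- by rewrite poweR_EFin -powRrM mulfV ?gt_eqF// powRr1.
Qed.

(** Averaging [`|f y - f (x i)| <= c i * mdist y (x i) <= r * c i] over the
    balls, with [c i] the local Lipschitz constant. *)
Lemma empirical_integral_bound (mu : probability (borel T) R)
    (x : 'I_n -> borel T) (nu : 'I_n -> probability (borel T) R) (r : R) (f : T -> R) :
  (0 <= r)%R -> disintegration mu r x nu -> lipschitz_fun f ->
  `| \int[mu]_y (f y)%:E - \int[empirical_measure x]_y (f y)%:E |
  <= r%:E * ((n%:R^-1)%:E * \sum_(i < n) lip_norm f (cball (x i : T) r)).
Proof.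
move=> r0 [nu1 muE] lf.
have mf : measurable_fun setT (f : borel T -> R).
  exact: continuous_borel_measurableR (lipschitz_continuous _ _ _ lf).
have mEf : measurable_fun setT (EFin \o (f : borel T -> R)).
  exact/measurable_EFinP.
have /choice[c cP] i : exists c : R,
    lip_norm f (cball (x i : T) r) = c%:E /\
    lipschitz_const (cball (x i : T) r) f c.
  by have [c ? ?] := lip_norm_attained _ _ _ (cball (x i : T) r) lf; exists c.
have xx i : cball (x i : T) r (x i) by rewrite /cball /= mdistxx.
have cr0 i : (0 <= r * c i)%R by rewrite mulr_ge0//; case: (cP i) => _ [].
have close i y : cball (x i : T) r y -> (`|f y - f (x i)| <= r * c i)%R.
  move=> yx; case: (cP i) => _ [c0 fc]; apply: le_trans (fc _ _ yx (xx i)) _.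
  by rewrite mulrC ler_wpM2r// metric_sym.
have nuP i := integral_sub_le_on_full_set _ _ _ (nu i) _ _ _ _
  (cball_measurable _ _ (x i) r) (nu1 i) mf (cr0 i) (close i).
(* Finite values, so that the rest is a computation in [R]. *)
pose a i := fine (\int[nu i]_y (f y)%:E).
have aE i : \int[nu i]_y (f y)%:E = (a i)%:E.
  by rewrite fineK//; apply: integrable_fin_num => //; case: (nuP i).
have -> : \int[mu]_y (f y)%:E = (n%:R^-1 * \sum_(i < n) a i)%:E.
  rewrite (@eq_measure_integral _ _ _ _ (umix nu)); last first.
    by move=> A mA _; exact: muE.
  rewrite integral_umix//; last by move=> i; case: (nuP i).
  by rewrite EFinM -sumEFin; congr (_ * _); apply: eq_bigr => i _; exact: aE.
have -> : \int[empirical_measure x]_y (f y)%:E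
    = (n%:R^-1 * \sum_(i < n) f (x i))%:E.
  have dE i : \int[\d_(x i : borel T)]_y (f y)%:E = (f (x i))%:E.
    by rewrite integral_dirac// diracT mul1e.
  rewrite /empirical_measure integral_umix//.
    by rewrite EFinM -sumEFin; congr (_ * _); apply: eq_bigr => i _; exact: dE.
  move=> i; apply/integrableP; split => //.
  rewrite integral_dirac// ?diracT ?mul1e//= ?ltry//.
  by apply/measurable_EFinP; exact: measurableT_comp.
rewrite (eq_bigr (fun i => (c i)%:E)); last by move=> i _; case: (cP i).
rewrite sumEFin -!EFinM -EFinB lee_fin -mulrBr -sumrB normrM.
rewrite ger0_norm ?invr_ge0//.
rewrite mulrCA ler_wpM2l ?invr_ge0// mulr_sumr.
apply: le_trans (ler_norm_sum _ _ _) _; apply: ler_sum => i _.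
by have [_] := nuP i; rewrite aE -EFinB lee_fin.
Qed.

End disintegration_bounds.

(** * Deviation of the empirical measure *)

Theorem theorem1p2 (R : realType) (T : pmetricType R) (polishT : polish T)
    (mu : probability (borel T) R) (eps r : nat -> R)
    (mu_disint : asymptotically_disintegrable mu eps r) :
  \forall n \near \oo,
    forall (d : measure_display) (Psi : measurableType d)
      (P : probability Psi R) (X : 'I_n -> {RV P >-> borel T}),
    iid X mu ->
    (forall p : R, 1 <= p ->
       with_probability_ge P (1 - eps n)
         [set w | (wasserstein p mu (empirical_measure (fun i => X i w))
                   <= (r n)%:E)%E]) /\
    with_probability_ge P (1 - eps n)
      [set w | forall f : T -> R, lipschitz_fun f ->
         (`| \int[mu]_x (f x)%:E
             - \int[empirical_measure (fun i => X i w)]_x (f x)%:E |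
          <= (r n)%:E * ((n%:R^-1)%:E *
               \sum_(i < n) lip_norm f (cball (X i w : T) (r n))))%E].
Proof.
case: mu_disint => _ [r0 _] disint; near=> n => d Psi P X iidX.
have n0 : (0 < n)%N by near: n; exact: nbhs_infty_gt.
have : disintegrable mu n (eps n) (r n) by near: n.
move=> /(_ _ _ _ _ iidX) [E [mE PE Edis]].
split=> [p p1|]; exists E; split=> // w /Edis/= [nu nuP].
  exact: wasserstein_le n0 (r0 _ n0) p1 nuP.
by move=> f lf; exact: empirical_integral_bound (r0 _ n0) nuP lf.
Unshelve. all: by end_near. Qed.
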